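(* Let a list of real numbers $\sigma=(\lambda_1,\lambda_2,\dots,\lambda_5)$, where $\lambda_1\ge\lambda_2\ge\dots\ge\lambda_5\ge-\lambda_1$ and $\lambda_3\le\sum_{i=1}^5\lambda_i$, be the spectrum of a $5\times5$ symmetric nonnegative matrix. Then $\sigma_i^{+s}$ and $\sigma_i^{-s}$ are realizable by $5\times5$ symmetric nonnegative matrices for any positive real number $s$ and any $i\in\{2,3,4,5\}$.
   Context: For $s>0$ and $i\in\{2,\dots,5\}$, $\sigma_i^{+s}$ denotes the list $\sigma$ with $\lambda_1$ replaced by $\lambda_1+s$ and $\lambda_i$ replaced by $\lambda_i+s$; $\sigma_i^{-s}$ denotes the list $\sigma$ with $\lambda_1$ replaced by $\lambda_1+s$ and $\lambda_i$ replaced by $\lambda_i-s$. A matrix is nonnegative if all its entries are nonnegative real numbers. A list is realizable by a matrix if it is the spectrum of that matrix, eigenvalues being counted with multiplicity and the order of the list being irrelevant. *)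

(* Defs.v *)
From mathcomp Require Export all_boot all_order all_algebra.
From mathcomp Require Export reals.

Set Implicit Arguments.
Unset Strict Implicit.
Unset Printing Implicit Defensive.

Import Order.TTheory GRing.Theory Num.Theory.
Local Open Scope ring_scope.

(* Eigenvalues are counted with algebraic multiplicity, so the order of the
   list is irrelevant. *)
Definition is_spectrum (R : realType) (n : nat) (A : 'M[R]_n) (l : seq R) : Prop :=
  char_poly A = \prod_(x <- l) ('X - x%:P).

Definition sym_nonneg (R : realType) (n : nat) (A : 'M[R]_n) : Prop :=
  A^T = A /\ A \is a mxOver Num.nneg.

Definition sym_realizable (R : realType) (n : nat) (l : n.-tuple R) : Prop :=
  exists A : 'M[R]_n, sym_nonneg A /\ is_spectrum A l.

(* Lists are indexed from 0: the entry lambda_k is [tnth l] at index k - 1.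
   Only used for i != ord0. *)
Definition perturb (R : realType) (n : nat) (l : n.+1.-tuple R) (i : 'I_n.+1)
    (s t : R) : n.+1.-tuple R :=
  [tuple (if j == ord0 then tnth l j + s
          else if j == i then tnth l j + t
          else tnth l j) | j < n.+1].

Definition perturb_plus (R : realType) (n : nat) (l : n.+1.-tuple R)
    (i : 'I_n.+1) (s : R) : n.+1.-tuple R := perturb l i s s.

Definition perturb_minus (R : realType) (n : nat) (l : n.+1.-tuple R)
    (i : 'I_n.+1) (s : R) : n.+1.-tuple R := perturb l i s (- s).

(* Main.v *)
Require Import Defs.
From mathcomp Require Import ring lra zify.

(* For a sorted list with lambda_3 <= T, where T is the trace, and
   lambda_1 + lambda_5 >= 0, realizability is equivalent to T >= 0 together with
   lambda_1 + lambda_3 + lambda_4 >= 0.  These inequalities survive the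
   perturbations, because moving one lambda_i by t with |t| <= s moves the sum of
   any set of entries of the sorted tail by at most s, while lambda_1 grows by s
   and T by s + t >= 0.
   Necessity (McDonald and Neumann) reads lambda_2 + lambda_5 <= T.  Among the
   sign classes of orthogonal eigenvectors for lambda_1 and lambda_2, a nonempty
   one has at most two indices; the Rayleigh quotient of the corresponding part
   of the eigenvector is at least lambda_2, that of the orthogonal vector
   supported on the same two indices is at least lambda_5, and the two quotients
   sum to the trace of a 2 x 2 principal submatrix.
   For sufficiency, matrices are glued along their Perron vectors (Fiedler),
   starting from 1 x 1 matrices. *)

Set Implicit Arguments.
Unset Strict Implicit.
Unset Printing Implicit Defensive.

Import Order.TTheory GRing.Theory Num.Theory.
Local Open Scope ring_scope.

(** * Determinants of matrices coupled by rank-one terms *)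

Lemma det_add_rank1 (K : comNzRingType) n (M : 'M[K]_n) (w : 'rV[K]_n) (m c : K) :
  w *m w^T = 1%:M -> M *m w^T = m *: w^T ->
  m * \det (M + c *: (w^T *m w)) = (m + c) * \det M.
Proof.
move=> ww Mw.
(* Evaluating the bordered matrix [C] in two ways moves the eigenvalue [m] of [w^T] to [m + c]
   without dividing by [m], so polynomial entries are allowed. *)
pose C := block_mx 1%:M (- (c *: w)) w^T M.
have CE : C = block_mx 1%:M 0 w^T 1%:M *m
              block_mx 1%:M (- (c *: w)) 0 (M + c *: (w^T *m w)).
  rewrite mulmx_block !mul1mx !mul0mx !mulmx1 !addr0 mulmxN -scalemxAr.
  by rewrite addrCA addNr addr0.
have detC : \det C = \det (M + c *: (w^T *m w)).
  by rewrite CE det_mulmx det_lblock det_ublock !det1 !mul1r.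
have CE' : C *m block_mx m%:M 0 (- w^T) 1%:M =
           block_mx (m + c)%:M (- (c *: w)) 0 M.
  rewrite mulmx_block !mul1mx !mulmx0 !mulmx1 !add0r mulNmx mulmxN opprK.
  rewrite -scalemxAl ww mulmxN Mw mul_mx_scalar subrr.
  by rewrite scalemx1 -raddfD.
have := congr1 (fun X => \det X) CE'; rewrite det_mulmx det_lblock det_ublock.
by rewrite det1 !det_scalar1 mulr1 detC mulrC.
Qed.

(** A Schur complement without inverses: the eigenvector equation for [M] clears the upper right
    block and leaves [a *: N - r ^+ 2 *: (v^T *m v)], a rank-one change of a matrix with eigenvalue
    [a * b] on [v^T]. The factor [a * b] stays on the left because it will be a non-invertible
    polynomial. *)
Lemma det_glue (K : idomainType) n p (M : 'M[K]_n) (N : 'M[K]_p)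
    (u : 'rV[K]_n) (v : 'rV[K]_p) (a b r : K) :
  a != 0 -> u *m u^T = 1%:M -> v *m v^T = 1%:M ->
  M *m u^T = a *: u^T -> N *m v^T = b *: v^T ->
  a * b * \det (block_mx M (r *: (u^T *m v)) (r *: (v^T *m u)) N) =
  (a * b - r ^+ 2) * (\det M * \det N).
Proof.
move=> a0 uu vv Mu Nv; set C := block_mx _ _ _ _.
have CE : C *m block_mx 1%:M (- (r *: (u^T *m v))) 0 a%:M =
    block_mx M 0 (r *: (v^T *m u)) (a *: N - r ^+ 2 *: (v^T *m v)).
  rewrite mulmx_block !mulmx1 !mulmx0 !addr0 !mulmxN -!scalemxAr -!scalemxAl.
  rewrite !mul_mx_scalar mulmxA Mu -scalemxAl scalerA mulrC -scalerA addNr.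
  by rewrite mulmxA -[v^T *m u *m _]mulmxA uu mulmx1 scalerA addrC.
have := congr1 (fun X => \det X) CE.
rewrite det_mulmx det_lblock det_ublock det1 mul1r det_scalar => detC.
have := @det_add_rank1 K p (a *: N) v (a * b) (- r ^+ 2) vv.
rewrite -scalemxAl Nv scalerA scaleNr detZ => /(_ erefl) detD.
(* The factor [a ^+ p] is the determinant of the block [a%:M] in [CE]. *)
apply: (mulIf (expf_neq0 p a0)).
rewrite -mulrA detC mulrCA detD; ring.
Qed.

(** * Gluing along Perron vectors, and sufficiency *)

Section PerronGluing.
Variable R : realType.
Implicit Types (l k : seq R).

(** The root [a] is kept apart from the other eigenvalues because gluing replaces it; nonnegativity
    of [u] makes the off-diagonal blocks nonnegative. *)
Definition perron_realizable n (a : R) (l : seq R) : Prop :=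
  exists (A : 'M[R]_n) (u : 'rV[R]_n),
    [/\ sym_nonneg A, is_spectrum A (a :: l),
        u \is a mxOver Num.nneg, u *m u^T = 1%:M & u *m A = a *: u].

Lemma perron_realizable1 (a : R) : 0 <= a -> perron_realizable 1 a [::].
Proof.
move=> a0; exists a%:M, 1%:M; split.
- by split; [rewrite tr_scalar_mx | apply/mxOver_scalar; rewrite ?nnegrE].
- rewrite /is_spectrum /char_poly /char_poly_mx det_mx11 !mxE !eqxx /=.
  by rewrite big_cons big_nil mulr1 !mulr1n.
- by apply/mxOver_scalar; rewrite nnegrE ?ler01.
- by rewrite trmx1 mulmx1.
- by rewrite mul1mx scalemx1.
Qed.

Lemma glue2 (a b g : R) : a <= g -> b <= g ->
  exists p q r, [/\ [/\ 0 <= p, 0 <= q & 0 <= r], p ^+ 2 + q ^+ 2 = 1,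
    a * p + r * q = g * p, r * p + b * q = g * q &
    r ^+ 2 = (g - a) * (g - b)].
Proof.
(* The eigenvector for [g] is proportional to [(sqrt (g - b), sqrt (g - a))], of squared norm
   [g - a + (g - b)]; if this vanishes, the matrix is [g] times the identity and [(1, 0)] serves. *)
move=> ag bg; have [e|ne] := eqVneq (g - a + (g - b)) 0.
  have ea : a = g by lra.
  have eb : b = g by lra.
  exists 1, 0, 0; rewrite ea eb; split; rewrite ?ler01 ?lexx //; ring.
set t := g - a + (g - b) in ne.
have t0 : 0 < t by rewrite lt_def ne /t; lra.
pose x := Num.sqrt (g - a); pose y := Num.sqrt (g - b); pose z := Num.sqrt t.
have xE : x ^+ 2 = g - a by rewrite sqr_sqrtr //; lra.
have yE : y ^+ 2 = g - b by rewrite sqr_sqrtr //; lra.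
have zE : z ^+ 2 = t by rewrite sqr_sqrtr // ltW.
have z0 : z != 0 by rewrite -sqrf_eq0 zE gt_eqF.
exists (y / z), (x / z), (x * y); split.
- by rewrite !(divr_ge0, mulr_ge0, sqrtr_ge0).
- by rewrite !expr_div_n -mulrDl xE yE zE addrC divff.
- have -> : a = g - x ^+ 2 by lra.
  ring.
- have -> : b = g - y ^+ 2 by lra.
  ring.
- by rewrite exprMn xE yE.
Qed.

(* Fiedler: the blocks interact only through the plane spanned by their Perron
   vectors, where [[a, r], [r, b]] has eigenvalues g and a + b - g. *)
Lemma perron_glue n m (a b g : R) l k :
  perron_realizable n a l -> perron_realizable m b k -> a <= g -> b <= g ->
  perron_realizable (n + m) g (a + b - g :: l ++ k).
Proof.
move=> [A [u [[As An] Ac un uu uA]]] [B [v [[Bs Bn] Bc vn vv vB]]] ag bg.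
have [p [q [r [[p0 q0 r0] pq e1 e2 r2]]]] := glue2 ag bg.
exists (block_mx A (r *: (u^T *m v)) (r *: (v^T *m u)) B), (row_mx (p *: u) (q *: v)).
have uTv (x y : nat) (s : 'rV[R]_x) (t : 'rV[R]_y) : s \is a mxOver Num.nneg ->
  t \is a mxOver Num.nneg -> r *: (s^T *m t) \is a mxOver Num.nneg.
  move=> /mxOverP sn /mxOverP tn; apply/mxOverP => i j.
  rewrite !mxE big_ord1 !mxE nnegrE; have := sn ord0 i; have := tn ord0 j.
  by rewrite !nnegrE => *; rewrite !mulr_ge0.
split.
- split; first by rewrite tr_block_mx As Bs !linearZ /= !trmx_mul !trmxK.
  apply/mxOverP => i j; rewrite -[i]splitK -[j]splitK.
  case: (split i) => i'; case: (split j) => j';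
  rewrite /= ?(block_mxEul, block_mxEur, block_mxEdl, block_mxEdr);
  apply/mxOverP => //; exact: uTv.
(* Over [{poly R}], [det_glue] exchanges [('X - a) ('X - b)] for [('X - a) ('X - b) - r ^+ 2], which
   factors as [('X - g) ('X - (a + b - g))]. *)
- pose uP := map_mx polyC u; pose vP := map_mx polyC v.
  have := @det_glue {poly R} n m (char_poly_mx A) (char_poly_mx B) uP vP
     ('X - a%:P) ('X - b%:P) (- r%:P) (negbT (polyXsubC_eq0 _)).
  have unit x (s : 'rV[R]_x) : s *m s^T = 1%:M ->
      map_mx polyC s *m (map_mx polyC s)^T = 1%:M :> 'M[{poly R}]_1.
    by move=> e; rewrite map_trmx -map_mxM e map_mx1.
  have eig y (D : 'M[R]_y) (s : 'rV[R]_y) x : D^T = D -> s *m D = x *: s ->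
      char_poly_mx D *m (map_mx polyC s)^T = ('X - x%:P) *: (map_mx polyC s)^T.
    move=> Ds e; rewrite /char_poly_mx mulmxBl mul_scalar_mx map_trmx -map_mxM.
    by rewrite -{1}Ds -trmx_mul e linearZ /= map_mxZ scalerBl.
move=> /(_ (unit _ _ uu) (unit _ _ vv) (eig _ _ _ _ As uA) (eig _ _ _ _ Bs vB)).
  rewrite /is_spectrum /char_poly.
  have -> : char_poly_mx (block_mx A (r *: (u^T *m v)) (r *: (v^T *m u)) B) =
     block_mx (char_poly_mx A) (- r%:P *: (uP^T *m vP)) (- r%:P *: (vP^T *m uP))
       (char_poly_mx B).
    rewrite /char_poly_mx map_block_mx scalar_mx_block opp_block_mx add_block_mx.
    by rewrite !sub0r !map_mxZ !map_mxM !map_trmx !scaleNr.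
  rewrite -!/(char_poly _) Ac Bc !big_cons big_cat /= => e.
  apply: (mulfI (mulf_neq0 (negbT (polyXsubC_eq0 a)) (negbT (polyXsubC_eq0 b)))).
  rewrite e sqrrN -rmorphXn r2 /=; ring.
- apply/mxOverP => i j; rewrite -[j]splitK.
  by case: (split j) => j' /=; rewrite ?(row_mxEl, row_mxEr); apply/mxOverP;
    apply: mxOverZ; rewrite ?nnegrE.
- rewrite tr_row_mx mul_row_col !linearZ /= -!scalemxAl uu vv !scalerA.
  by rewrite -scalerDl -!expr2 pq scale1r.
- rewrite mul_row_block scale_row_mx -!scalemxAl -!scalemxAr uA vB !mulmxA uu vv.
  rewrite !mul1mx !scalerA -!scalerDl; congr (row_mx (_ *: _) (_ *: _)); lra.
Qed.

Lemma perron_glue_eq n m (a b g h : R) l k :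
  perron_realizable n a l -> perron_realizable m b k -> a <= g -> b <= g ->
  a + b = g + h -> perron_realizable (n + m) g (h :: l ++ k).
Proof.
move=> Pa Pb ag bg e; have -> : h = a + b - g by lra.
exact: perron_glue.
Qed.

Lemma perron_realizable2 (a b : R) : b <= a -> 0 <= a + b ->
  perron_realizable 2 a [:: b].
Proof.
move=> ba ab; have P : perron_realizable 1 ((a + b) / 2) [::].
  by apply: perron_realizable1; lra.
by apply: (perron_glue_eq (h := b) P P); lra.
Qed.

(** As [b <= 0], the root [a + b] of a 2 x 2 matrix with other eigenvalue [c] can be raised to [a]
    by gluing on the 1 x 1 zero matrix, which creates the eigenvalue [b]. *)
Lemma perron_realizable3 (a b c : R) : c <= b -> b <= 0 -> 0 <= a + b + c ->
  perron_realizable 3 a [:: b; c].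
Proof.
move=> cb b0 abc; have P2 : perron_realizable 2 (a + b) [:: c].
  by apply: perron_realizable2; lra.
by apply: (perron_glue_eq (h := b) P2 (perron_realizable1 (lexx 0))); lra.
Qed.

Lemma is_spectrum_perm n (A : 'M[R]_n) l k :
  perm_eq l k -> is_spectrum A l -> is_spectrum A k.
Proof. by move=> lk; rewrite /is_spectrum => ->; apply: perm_big. Qed.

(** For negative [c], matrices with spectra [a - t, c, d] and [b + t, e] are glued; otherwise those
    with spectra [b + t, d] and [a - t, e], and [c] is adjoined afterwards. Either way gluing turns
    the two roots into [a] and [b]. *)
Lemma sym_realizable5_sorted (a b c d e : R) l :
  b <= a -> c <= b -> d <= c -> e <= d -> - a <= e ->
  0 <= a + b + c + d + e -> c <= a + b + c + d + e -> 0 <= a + c + d ->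
  perm_eq [:: a; b; c; d; e] l ->
  exists A : 'M[R]_5, sym_nonneg A /\ is_spectrum A l.
Proof.
move=> ba cb dc ed ae T0 cT acd le.
suff [k [A [u [As Ac _ _ _]]] kE] : exists2 k, perron_realizable 5 a k &
    perm_eq (a :: k) [:: a; b; c; d; e].
  by exists A; split=> //; apply: is_spectrum_perm Ac; apply: perm_trans le.
have [c0|c0] := ltP c 0.
  exists [:: b; c; d; e] => //.
  (* The least shift making [b + t + e] nonnegative. The other block needs [0 <= a - t + c + d],
     which then reads [0 <= a + c + d] or says that the whole sum is nonnegative. *)
  pose t := Num.max 0 (- b - e).
  have [t0 tbe] : 0 <= t /\ - b - e <= t by rewrite !le_max !lexx orbT.
  have [bta at0] : b + t <= a /\ 0 <= a - t + c + d.
    by rewrite /t; have [h|h] := leP 0 (- b - e); split; lra.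
  have P3 : perron_realizable 3 (a - t) [:: c; d].
    by apply: perron_realizable3; lra.
  have P2 : perron_realizable 2 (b + t) [:: e].
    by apply: perron_realizable2; lra.
  by apply: (perron_glue_eq (h := b) P3 P2); lra.
exists [:: c; b; d; e]; last first.
  by rewrite perm_cons; exact: permEl (perm_catCA [:: c] [:: b] _).
(* Likewise for [b + t + d]. When [t] is positive, [0 <= a - t + e] reads [0 <= a + b + d + e],
   which is the hypothesis [cT]. *)
pose t := Num.max 0 (- b - d).
have [t0 tbd] : 0 <= t /\ - b - d <= t by rewrite !le_max !lexx orbT.
have [bta [at0 ea]] : b + t <= a /\ 0 <= a - t + e /\ e <= a - t.
  by rewrite /t; have [h|h] := leP 0 (- b - d); (split; last split); lra.
have P2 : perron_realizable 2 (b + t) [:: d].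
  by apply: perron_realizable2; lra.
have P2' : perron_realizable 2 (a - t) [:: e].
  by apply: perron_realizable2; lra.
have P4 : perron_realizable 4 a [:: b; d; e].
  by apply: (perron_glue_eq (h := b) P2 P2'); lra.
(* The root of the larger block is already [a], so the coupling is zero and the sum is direct. *)
by apply: (perron_glue_eq (h := c) P4 (perron_realizable1 c0)); lra.
Qed.

(** After a perturbation the moved entry [x] may stand anywhere among the sorted [p, q, r]. Each
    implication supplies, for one position, the inequalities on the third and fourth largest
    entries. *)
Lemma sym_realizable5_insert (a x p q r T : R) k : T = a + x + p + q + r ->
  p <= a -> q <= p -> r <= q -> - a <= r -> x <= a -> - a <= x -> 0 <= T ->
  (p <= x -> p <= T /\ 0 <= a + p + q) ->
  (q <= x -> x <= p -> x <= T /\ 0 <= a + x + q) ->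
  (r <= x -> x <= q -> q <= T /\ 0 <= a + q + x) ->
  (x <= r -> q <= T /\ 0 <= a + q + r) ->
  perm_eq [:: x; p; q; r] k ->
  exists A : 'M[R]_5, sym_nonneg A /\ is_spectrum A (a :: k).
Proof.
rewrite -(perm_cons a) => TE pa qp rq ar xa ax T0 h1 h2 h3 h4 pl.
move: T0 h1 h2 h3 h4; rewrite TE => T0 h1 h2 h3 h4.
have [px|xp] := leP p x.
  have [? ?] := h1 px.
  by apply: (sym_realizable5_sorted _ _ _ _ _ _ _ _ pl); lra.
have [qx|xq] := leP q x.
  have [? ?] := h2 qx (ltW xp).
  apply: (sym_realizable5_sorted (a := a) (b := p) (c := x) (d := q) (e := r)); try lra.
  apply: perm_trans pl; rewrite perm_cons.
  exact: permEl (perm_catCA [:: p] [:: x] _).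
have [rx|xr] := leP r x.
  have [? ?] := h3 rx (ltW xq).
  apply: (sym_realizable5_sorted (a := a) (b := p) (c := q) (d := x) (e := r)); try lra.
  apply: perm_trans pl; rewrite perm_cons.
  exact: permEl (perm_catCA [:: p; q] [:: x] _).
have [? ?] := h4 (ltW xr).
apply: (sym_realizable5_sorted (a := a) (b := p) (c := q) (d := r) (e := x)); try lra.
apply: perm_trans pl; rewrite perm_cons.
exact: permEl (perm_catC [:: p; q; r] [:: x]).
Qed.

End PerronGluing.

(** * Spectral theorem for symmetric matrices *)

Section Spectral.
Variable R : rcfType.

Lemma dotr_ge0 n (v : 'rV[R]_n) : 0 <= (v *m v^T) 0 0.
Proof. by rewrite !mxE sumr_ge0 // => i _; rewrite mxE -expr2 sqr_ge0. Qed.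

Lemma dotr_eq0 n (v : 'rV[R]_n) : ((v *m v^T) 0 0 == 0) = (v == 0).
Proof.
apply/eqP/eqP=> [|->]; last by rewrite mul0mx mxE.
rewrite !mxE => /eqP; rewrite psumr_eq0 => [/allP v0|i _]; last first.
  by rewrite mxE -expr2 sqr_ge0.
apply/rowP => i; have := v0 i (mem_index_enum _).
by rewrite !mxE -expr2 sqrf_eq0 => /eqP.
Qed.

(* The Householder reflection exchanging v and the first basis vector. *)
Lemma orthogonal_completion n (v : 'rV[R]_(1 + n)) : v *m v^T = 1%:M ->
  exists2 H : 'M[R]_(1 + n), H *m H^T = 1%:M & row_mx 1%:M 0 *m H = v.
Proof.
set e : 'rV[R]_(1 + n) := row_mx 1%:M 0 => vv.
have ee : e *m e^T = 1%:M by rewrite /e tr_row_mx mul_row_col trmx1 mul1mx mul0mx addr0.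
have [->|ve] := eqVneq v e; first by exists 1%:M; rewrite ?trmx1 mulmx1.
pose w := v - e; pose k := (w *m w^T) 0 0.
have k0 : k != 0 by rewrite dotr_eq0 subr_eq0.
have wwk : w *m w^T = k%:M by rewrite [LHS]mx11_scalar.
pose H := 1%:M - (2 / k) *: (w^T *m w).
have Hs : H^T = H by rewrite /H linearB /= trmx1 linearZ /= trmx_mul trmxK.
exists H.
  pose S := w^T *m w.
  have SS : S *m S = k *: S.
    by rewrite /S -mulmxA [w *m (_ *m _)]mulmxA wwk mul_scalar_mx -scalemxAr.
  rewrite Hs /H -/S mulmxBl mul1mx -scalemxAl mulmxBr mulmx1 -scalemxAr SS.
  rewrite [_ *: (k *: S)]scalerA divfK // scalerBr [2 *: S]scaler_nat.
  by rewrite [S *+ 2]mulr2n scalerDr opprB addrK subrK.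
have ve' : v *m e^T = e *m v^T.
  have -> : e *m v^T = (v *m e^T)^T by rewrite trmx_mul trmxK.
  by rewrite [v *m _]mx11_scalar tr_scalar_mx.
(* As [v] and [e] are unit vectors, [k] is twice [1 - e *m v^T], so the reflection sends [e] to
   [e + w], which is [v]. *)
have kE : k%:M = 2 *: (1%:M - e *m v^T).
  rewrite -wwk /w linearB /= mulmxBl !mulmxBr vv ee ve'.
  by rewrite opprB scaler_nat mulr2n.
have ew : e *m w^T = (- (k / 2))%:M.
  rewrite /w linearB /= mulmxBr ee -opprB raddfN /=; congr (- _).
  by rewrite mulrC -scale_scalar_mx kE scalerA mulVf ?scale1r // pnatr_eq0.
rewrite /H mulmxBr mulmx1 -scalemxAr mulmxA ew mul_scalar_mx scalerA mulrN.
rewrite scaleNr opprK mulrA divfK // divff ?pnatr_eq0 // scale1r.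
by rewrite /w addrC subrK.
Qed.

(** By deflation: a unit eigenvector is completed to an orthogonal [H], and by symmetry
    [H *m A *m H^T] splits off [d 0 0]. The order of [d] is kept, so row [i] of [Q] is an
    eigenvector for [d 0 i]. *)
Lemma spectral_sym n (A : 'M[R]_n) (d : 'rV[R]_n) : A^T = A ->
  char_poly A = \prod_i ('X - (d 0 i)%:P) ->
  exists2 Q : 'M[R]_n, Q *m Q^T = 1%:M & Q *m A = diag_mx d *m Q.
Proof.
elim: n A d => [|n IHn] A d As Ac; first by exists 0; apply/matrixP; case.
have : eigenvalue A (d 0 0).
  rewrite eigenvalue_root_char Ac big_ord_recl rootM; apply/orP; left.
  by rewrite root_XsubC.
move=> /eigenvalueP[v0 v0A v0n].
pose k := (v0 *m v0^T) 0 0.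
have k0 : 0 < k by rewrite lt_def dotr_eq0 v0n dotr_ge0.
pose v := (Num.sqrt k)^-1 *: v0.
have vv : v *m v^T = 1%:M.
  rewrite linearZ /= -scalemxAl -scalemxAr scalerA [X in _ *: X]mx11_scalar -/k.
  by rewrite scale_scalar_mx -expr2 exprVn sqr_sqrtr ?ltW // mulVf // gt_eqF.
have vA : v *m A = d 0 0 *: v by rewrite -scalemxAl v0A !scalerA mulrC.
have [H HH eH] := @orthogonal_completion n v vv.
pose B : 'M_(1 + n) := H *m A *m H^T.
have Bs : B^T = B by rewrite /B !trmx_mul trmxK As mulmxA.
have BH : B *m H = H *m A by rewrite /B -!mulmxA (mulmx1C HH) mulmx1.
have eB : row_mx 1%:M 0 *m B = d 0 0 *: row_mx 1%:M 0.
  by rewrite /B !mulmxA eH vA -scalemxAl -eH -mulmxA HH mulmx1.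
have [B1 B2] : ulsubmx B = (d 0 0)%:M /\ ursubmx B = 0.
  move: eB; rewrite -{1}[B]submxK mul_row_block !mul1mx !mul0mx !addr0.
  by rewrite scale_row_mx scaler0 scalemx1 => /eq_row_mx.
have BE : B = block_mx (d 0 0)%:M 0 0 (drsubmx B).
  rewrite -[LHS]submxK B1 B2; congr block_mx.
  by rewrite -{1}Bs -trmx_ursub B2 trmx0.
have Bc : char_poly B = char_poly A.
  rewrite /char_poly; pose HP := map_mx polyC H.
  have HPT : HP *m HP^T = 1%:M by rewrite map_trmx -map_mxM HH map_mx1.
  have -> : char_poly_mx B = HP *m char_poly_mx A *m HP^T.
    rewrite /char_poly_mx mulmxBr mulmxBl mul_mx_scalar -scalemxAl HPT scalemx1.
    by rewrite map_trmx /HP -!map_mxM.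
  by rewrite !det_mulmx mulrAC -det_mulmx HPT det1 mul1r.
have [||Q QQ QB] := IHn (drsubmx B) (@rsubmx _ 1 1 n d).
- by rewrite trmx_drsub Bs.
- move: Bc; rewrite {1}BE {1}/char_poly char_block_diag_mx det_ublock Ac big_ord_recl.
  rewrite {1}/char_poly_mx det_mx11 !mxE eqxx !mulr1n.
  move/(mulfI (negbT (polyXsubC_eq0 _))); rewrite -/(char_poly _) => ->.
  by apply: eq_bigr => i _; rewrite mxE; congr ('X - (d _ _)%:P); apply: val_inj.
pose G : 'M_(1 + n) := block_mx 1%:M 0 0 Q.
have GG : G *m G^T = 1%:M.
  rewrite tr_block_mx mulmx_block !trmx0 !mulmx0 !mul0mx trmx1 mulmx1 QQ.
  by rewrite !addr0 add0r -scalar_mx_block.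
have GB : G *m B = @diag_mx _ (1 + n) d *m G.
  rewrite BE mulmx_block !mulmx0 !mul0mx !addr0 !add0r mul1mx QB.
  rewrite -[d in RHS](@hsubmxK _ 1 1 n) diag_mx_row mulmx_block.
  rewrite !mulmx0 !mul0mx !addr0 !add0r mulmx1; congr block_mx.
  by rewrite [diag_mx _]mx11_scalar !mxE mulr1n; congr (d _ _)%:M; apply: val_inj.
exists (G *m H).
  by rewrite trmx_mul mulmxA -[_ *m H *m _]mulmxA HH mulmx1.
by rewrite -[LHS]mulmxA -BH mulmxA GB -mulmxA.
Qed.
End Spectral.

(** * Necessity: the McDonald-Neumann inequality *)

Section Necessary.
Variable R : realType.

Lemma rayleigh n (A Q : 'M[R]_n) (d : 'rV[R]_n) (c : R) (x : 'rV[R]_n) :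
  Q *m Q^T = 1%:M -> Q *m A = diag_mx d *m Q -> (forall i, c <= d 0 i) ->
  c * (x *m x^T) 0 0 <= (x *m A *m x^T) 0 0.
Proof.
move=> QQ QA cd; pose y := x *m Q^T.
have xy : x = y *m Q by rewrite /y -mulmxA (mulmx1C QQ) mulmx1.
have -> : x *m x^T = y *m y^T.
  by rewrite xy trmx_mul mulmxA -[y *m Q *m _]mulmxA QQ mulmx1.
have -> : x *m A *m x^T = y *m diag_mx d *m y^T.
  have QAQ : Q *m A *m Q^T = diag_mx d by rewrite QA -mulmxA QQ mulmx1.
  by rewrite -QAQ xy trmx_mul !mulmxA.
rewrite mul_mx_diag !mxE mulr_sumr; apply: ler_sum => i _.
rewrite !mxE mulrAC [leRHS]mulrC; apply: ler_wpM2r => //.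
by rewrite -expr2 sqr_ge0.
Qed.

Definition pos_part n (v : 'rV[R]_n) : 'rV[R]_n := map_mx (Num.max 0) v.
Definition pos_set n (v : 'rV[R]_n) : {set 'I_n} := [set i | 0 < v 0 i].

(* Pair [v A = c v] with the positive part of [v]: the negative part of [v]
   contributes nonpositively, as A >= 0. *)
Lemma pos_part_form n (A : 'M[R]_n) (v : 'rV[R]_n) (c : R) :
  A \is a mxOver Num.nneg -> v *m A = c *: v ->
  c * (pos_part v *m (pos_part v)^T) 0 0 <=
  (pos_part v *m A *m (pos_part v)^T) 0 0.
Proof.
move=> /mxOverP An vA; set p := pos_part v; set q := pos_part (- v).
have vE : v = p - q.
  apply/rowP => i; rewrite !mxE; case: (ltgtP 0 (v 0 i)) => h.
  - by rewrite [Num.max _ (- _)]max_l ?oppr_le0 ?ltW // subr0.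
  - by rewrite max_r ?oppr_ge0 ?ltW // sub0r opprK.
  - by rewrite -h oppr0 maxxx subr0.
have p0 i : 0 <= p 0 i by rewrite mxE le_max lexx.
have q0 i : 0 <= q 0 i by rewrite mxE le_max lexx.
have vp : v *m p^T = p *m p^T.
  apply/rowP => i; rewrite !mxE; apply: eq_bigr => j _; rewrite !mxE !ord1.
  case: (ltP 0 (v 0 j)) => // h; rewrite mulr0 ?mul0r //.
have -> : c * (p *m p^T) 0 0 = (v *m A *m p^T) 0 0.
  by rewrite vA -scalemxAl vp [RHS]mxE.
rewrite {1}vE !mulmxBl [leLHS]mxE [X in _ + X]mxE lerBlDr lerDl mxE.
rewrite sumr_ge0 // => i _; rewrite !mxE mulr_ge0 ?le_max ?lexx //.
by apply: sumr_ge0 => j _; rewrite mulr_ge0 //; have := An j i; rewrite nnegrE.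
Qed.

Lemma card_disjoint_pos_set n (v w : 'rV[R]_n) :
  (forall i, 0 < v 0 i -> w 0 i <= 0) -> (#|pos_set v| + #|pos_set w| <= n)%N.
Proof.
move=> vw; rewrite -cardsUI [_ :&: _](_ : _ = set0) ?cards0 ?addn0.
  by rewrite -[leqRHS]card_ord max_card.
apply/setP => i; rewrite !inE; apply/negbTE/negP => /andP[vi].
by rewrite ltNge vw.
Qed.

Lemma pos_set0 n (v : 'rV[R]_n) i : pos_set v = set0 -> v 0 i <= 0.
Proof. by move/setP/(_ i); rewrite !inE leNgt => ->. Qed.

(** Otherwise every nonempty positive set has at least three of the five indices. Then [x] and [- x]
    cannot both have one, so [v] and [w] are nonnegative up to sign; being orthogonal they have
    disjoint supports, again too large to fit. *)
Lemma small_pos_set (v w : 'rV[R]_5) : v != 0 -> w != 0 -> v *m w^T = 0 ->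
  exists z : 'rV[R]_5, [/\ z \in [:: v; - v; w; - w], pos_set z != set0 &
    (#|pos_set z| <= 2)%N].
Proof.
move=> v0 w0 vw; pose small (z : 'rV[R]_5) := (pos_set z != set0) && (#|pos_set z| <= 2)%N.
have [/hasP[z zin /andP[]]|/hasPn big] := boolP (has small [:: v; - v; w; - w]).
  by exists z.
have sgn (x : 'rV[R]_5) : x != 0 -> ~~ small x -> ~~ small (- x) ->
    exists2 y : 'rV[R]_5, (y == x) || (y == - x) &
      pos_set y != set0 /\ forall i, 0 <= y 0 i.
  move=> x0; rewrite /small.
  have xN i : 0 < x 0 i -> (- x) 0 i <= 0 by rewrite mxE oppr_le0 => /ltW.
  have := card_disjoint_pos_set xN.
  have [e|ne] := eqVneq (pos_set (- x)) set0 => /= c5 h1 h2.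
    exists x; rewrite ?eqxx //; split=> [|i]; last first.
      by have := pos_set0 i e; rewrite mxE oppr_le0.
    apply: contra x0 => /eqP e'; apply/eqP/rowP => i; rewrite mxE; apply/eqP.
    by rewrite eq_le pos_set0 //=; have := pos_set0 i e; rewrite mxE oppr_le0.
  have e : pos_set x = set0.
    by apply/eqP; apply: contraNT h1 => -> /=; lia.
  exists (- x); rewrite ?eqxx ?orbT //; split=> // i.
  by have := pos_set0 i e; rewrite mxE oppr_ge0.
have [||y yv [y0 yn]] := sgn v v0; rewrite ?big ?inE ?eqxx ?orbT //.
have [||z zw [z0 zn]] := sgn w w0; rewrite ?big ?inE ?eqxx ?orbT //.
have yz : y *m z^T = 0.
  by case/orP: yv => /eqP ->; case/orP: zw => /eqP ->;
    rewrite ?linearN /= ?mulNmx ?mulmxN vw ?oppr0.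
have disj i : 0 < y 0 i -> z 0 i <= 0.
  move=> yi; move/matrixP/(_ 0 0)/eqP: yz; rewrite !mxE psumr_eq0; last first.
    by move=> k _; rewrite mxE mulr_ge0.
  move=> /allP/(_ i (mem_index_enum _)); rewrite mxE mulf_eq0 gt_eqF //=.
  by move/eqP ->.
have := card_disjoint_pos_set disj.
have ys : ~~ small y by case/orP: yv => /eqP ->; rewrite big ?inE ?eqxx ?orbT.
have zs : ~~ small z by case/orP: zw => /eqP ->; rewrite big ?inE ?eqxx ?orbT.
move: ys zs; rewrite /small y0 z0 /=; lia.
Qed.

(** Smaller sets are padded to a pair, so that a 2 x 2 principal submatrix is always at hand. *)
Lemma small_set_pair n (S : {set 'I_n.+2}) : (#|S| <= 2)%N ->
  exists i j, i != j /\ S \subset [set i; j].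
Proof.
rewrite leq_eqVlt ltnS leq_eqVlt ltnS leqn0 cards_eq0 => /or3P[].
- by move=> /cards2P[i [j [ij ->]]]; exists i, j.
- move=> /cards1P[i ->]; exists i, (lift i ord0).
  by rewrite neq_lift sub1set !inE eqxx.
- by move=> /eqP ->; exists ord0, (lift ord0 ord0); rewrite neq_lift sub0set.
Qed.

Lemma mcdonald_neumann_form (A : 'M[R]_5) (v w : 'rV[R]_5) (b c e : R) :
  A \is a mxOver Num.nneg -> A^T = A -> v != 0 -> w != 0 -> v *m w^T = 0 ->
  v *m A = b *: v -> w *m A = c *: w -> c <= b ->
  (forall x : 'rV[R]_5, e * (x *m x^T) 0 0 <= (x *m A *m x^T) 0 0) ->
  c + e <= \tr A.
Proof.
move=> An As v0 w0 vw vA wA cb rayl.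
have [z [zin z0 z2]] := small_pos_set v0 w0 vw.
set p := pos_part z.
have pA : c * (p *m p^T) 0 0 <= (p *m A *m p^T) 0 0.
  have pos x y : x *m A = y *: x -> c <= y -> c * (pos_part x *m (pos_part x)^T) 0 0 <=
      (pos_part x *m A *m (pos_part x)^T) 0 0.
    move=> /(pos_part_form An) h cy; apply: le_trans h.
    by rewrite ler_wpM2r // dotr_ge0.
  have eN x y : x *m A = y *: x -> - x *m A = y *: - x.
    by rewrite mulNmx scalerN => ->.
  move: zin; rewrite /p !inE => /or4P[] /eqP ->.
  - exact: pos _ _ vA cb.
  - exact: pos _ _ (eN _ _ _ vA) cb.
  - exact: pos _ _ wA (lexx c).
  - exact: pos _ _ (eN _ _ _ wA) (lexx c).
have [i [j [ij zij]]] := small_set_pair z2.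
have pij k : k != i -> k != j -> p 0 k = 0.
  move=> ki kj; have := subsetP zij k; rewrite !inE (negPf ki) (negPf kj).
  by rewrite mxE; case: ltP => // _ /(_ isT).
(* [y] is [p] turned by a right angle in the plane of the coordinates [i] and [j]: it has the same
   norm, and the cross terms in [A i j] cancel when the two forms are added. *)
pose y : 'rV[R]_5 := \row_k (if k == i then p 0 j else if k == j then - p 0 i else 0).
have sum2 (F : 'I_5 -> R) : (forall k, k != i -> k != j -> F k = 0) -> \sum_k F k = F i + F j.
  move=> F0; rewrite (bigD1 i) //= (bigD1 j) 1?eq_sym //= big1 ?addr0 // => k.
  by move=> /andP[ki kj]; apply: F0.
have dot2 (x : 'rV[R]_5) : (forall k, k != i -> k != j -> x 0 k = 0) ->
   (x *m x^T) 0 0 = x 0 i ^+ 2 + x 0 j ^+ 2.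
  by move=> x0; rewrite mxE sum2 ?mxE -?expr2 // => k ki kj; rewrite x0 ?mul0r.
have form2 (x : 'rV[R]_5) : (forall k, k != i -> k != j -> x 0 k = 0) ->
   (x *m A *m x^T) 0 0 = A i i * x 0 i ^+ 2 + A j j * x 0 j ^+ 2 + 2 * A i j * x 0 i * x 0 j.
  move=> x0; rewrite mxE sum2 ?mxE => [|k ki kj]; last by rewrite [x^T _ _]mxE x0 ?mulr0.
  rewrite !sum2 => [||]; try by move=> k ki kj; rewrite x0 ?mul0r.
  have -> : A j i = A i j by rewrite -[in LHS]As mxE.
  ring.
have y0 k : k != i -> k != j -> y 0 k = 0.
  by rewrite mxE => /negPf -> /negPf ->.
have yi : y 0 i = p 0 j by rewrite mxE eqxx.
have yj : y 0 j = - p 0 i by rewrite mxE eqxx eq_sym (negPf ij).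
have := rayl y; rewrite dot2 // form2 // yi yj.
move: pA; rewrite dot2 // form2 // => h1 h2.
set s := p 0 i ^+ 2 + p 0 j ^+ 2 in h1.
have s0 : 0 < s.
  have [k] := set0Pn _ z0; rewrite inE => zk.
  have := subsetP zij k; rewrite !inE => /(_ zk) /orP kij.
  have pk : 0 < p 0 k ^+ 2 by rewrite exprn_gt0 // mxE max_r // ltW.
  rewrite /s; case: kij pk => /eqP -> h.
    by rewrite ltr_wpDr // sqr_ge0.
  by rewrite ltr_wpDl // sqr_ge0.
have h3 : (c + e) * s <= (A i i + A j j) * s by rewrite /s in h1 *; lra.
have Ad k : 0 <= A k k by have /mxOverP/(_ k k) := An; rewrite nnegrE.
rewrite ler_pM2r // in h3; apply: le_trans h3 _.
rewrite /mxtrace (bigD1 i) //= (bigD1 j) 1?eq_sym //= addrA lerDl.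
by apply: sumr_ge0 => k _.
Qed.

Lemma sym_realizable5_necessary (a b c d e : R) (A : 'M[R]_5) :
  b <= a -> c <= b -> d <= c -> e <= d ->
  sym_nonneg A -> is_spectrum A [:: a; b; c; d; e] ->
  0 <= a + b + c + d + e /\ 0 <= a + c + d.
Proof.
move=> ba cb dc ed [As An] Ac.
have trE : \tr A = a + b + c + d + e.
  apply: oppr_inj; rewrite -char_poly_trace // Ac.
  rewrite (@coefPn_prod_XsubC _ [:: a; b; c; d; e]) //; congr (- _).
  by rewrite !big_cons big_nil; ring.
have tr0 : 0 <= \tr A.
  by apply: sumr_ge0 => i _; have /mxOverP/(_ i i) := An; rewrite nnegrE.
rewrite -trE; split=> //.
pose s := [:: a; b; c; d; e]; pose D : 'rV[R]_5 := \row_i s`_i.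
have [|Q QQ QA] := spectral_sym (d := D) As.
  by rewrite Ac (big_nth 0) big_mkord; apply: eq_bigr => i _; rewrite mxE.
have eig i : row i Q *m A = s`_i *: row i Q.
  by rewrite -row_mul QA mul_diag_mx; apply/rowP => j; rewrite !mxE.
have dot i j : row i Q *m (row j Q)^T = (i == j)%:R%:M.
  rewrite [LHS]mx11_scalar; congr (_%:M).
  have := congr1 (fun X : 'M_5 => X i j) QQ; rewrite !mxE => <-.
  by apply: eq_bigr => k _; rewrite !mxE.
have row0 i : row i Q != 0.
  apply/eqP => r0; have := dot i i; rewrite r0 mul0mx eqxx => /matrixP/(_ 0 0).
  by rewrite !mxE => /eqP; rewrite eq_sym oner_eq0.
pose i0 : 'I_5 := ord0; pose i1 : 'I_5 := lift ord0 ord0.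
(* [a + c + d] is the trace minus [b + e]. *)
suff : b + e <= \tr A by lra.
apply: (mcdonald_neumann_form An As (row0 i0) (row0 i1) _ (eig i0) (eig i1)) => //.
  by rewrite dot raddf0.
move=> x; apply: rayleigh QQ QA _ => i; rewrite mxE.
by case: i => [[|[|[|[|[|//]]]]] ?] /=; lra.
Qed.

End Necessary.

(** * Realizability of the perturbed lists *)

Theorem theorem4 (R : realType) (sigma : 5.-tuple R)
    (hsort : sorted >=%R sigma)
    (hlast : - sigma`_0 <= sigma`_4)
    (htrace : sigma`_2 <= \sum_(x <- sigma) x)
    (hreal : sym_realizable sigma)
    (s : R) (hs : 0 < s) (i : 'I_5) (hi : i != ord0) :
  sym_realizable (perturb_plus sigma i s) /\
  sym_realizable (perturb_minus sigma i s).
Proof.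
suff P t : - s <= t <= s -> sym_realizable (perturb sigma i s t).
  by split; apply: P; apply/andP; split; lra.
move=> /andP[st ts]; case: hreal => A [An Ac].
(* With natural numbers as indices, the perturbed list computes once [sigma] and [i] are
   concrete. *)
have E : tval (perturb sigma i s t) = [seq (if j == 0%N then sigma`_j + s
    else if j == i then sigma`_j + t else sigma`_j) | j <- iota 0 5].
  apply: (@eq_from_nth _ 0) => [|k]; rewrite size_tuple // => k5.
  rewrite (nth_map 0%N) ?size_iota // nth_iota // -[k]/(val (Ordinal k5)).
  by rewrite -tnth_nth tnth_mktuple (tnth_nth 0).
rewrite /sym_realizable E => {E}.
case: sigma hsort hlast htrace Ac => -[//|a[//|b[//|c[//|d[//|e[|//]]]]]] sz /=.
rewrite !big_cons big_nil => /and5P[ba cb dc ed _] ae cT Ac.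
have [T0 acd] := sym_realizable5_necessary ba cb dc ed An Ac.
(* In each case [x] is the moved entry and [p, q, r] are the three others, still sorted; the
   permutation returns [x] to its original place. *)
have ins := sym_realizable5_insert (a := a + s) erefl.
case: i hi => [[|[|[|[|[|//]]]]] //= ? _].
- apply: (ins _ _ _ _ _ _ _ _ _ _ _ _ _ _ _ _ (perm_refl [:: b + t; c; d; e]));
    by intros; try split; lra.
- apply: (ins _ _ _ _ _ _ _ _ _ _ _ _ _ _ _ _ (permEl (perm_catCA [:: c + t] [:: b] [:: d; e])));
    by intros; try split; lra.
- apply: (ins _ _ _ _ _ _ _ _ _ _ _ _ _ _ _ _ (permEl (perm_catCA [:: d + t] [:: b; c] [:: e])));
    by intros; try split; lra.
- apply: (ins _ _ _ _ _ _ _ _ _ _ _ _ _ _ _ _ (permEl (perm_catC [:: e + t] [:: b; c; d])));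
    by intros; try split; lra.
Qed.
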